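(* Let $L\ge 1$ and $S\ge 0$ be integers with $L+S\ge 2$. Then the $LS$-sequence of points $\{\xi_{L,S}^m\}_{m\ge 1}$ coincides with the sequence $\{\phi_{L,S}(n)\}_{n\in\mathbb{N}_{L,S}}$, where $\mathbb{N}_{L,S}$ is ordered by magnitude. That is, if $n_1<n_2<n_3<\cdots$ is the increasing enumeration of $\mathbb{N}_{L,S}$, then $\xi_{L,S}^m=\phi_{L,S}(n_m)$ for every $m\ge 1$.
   Context: Fix integers $L\ge 1$, $S\ge 0$ with $L+S\ge 2$, and let $\gamma$ be the positive solution of $Lx+Sx^2=1$ (so $\gamma=1/L$ if $S=0$). **$LS$-sequence of partitions.** Let $\rho_{L,S}$ be the partition of $[0,1[$ into $L$ consecutive ''long'' intervals of length $\gamma$ followed by $S$ consecutive ''short'' intervals of length $\gamma^2$. Set $\rho_{L,S}^0=\{[0,1[\}$ and, for $n\ge 1$, let $\rho_{L,S}^n$ be obtained from $\rho_{L,S}^{n-1}$ by subdividing every interval of maximal length positively homothetically to $\rho_{L,S}$. Let $t_n$, $l_n$, $s_n$ be the total number of intervals, the number of long intervals (length $\gamma^n$) and the number of short intervals (length $\gamma^{n+1}$) of $\rho_{L,S}^n$. Then $t_n=l_n+s_n$, $l_n=L\,l_{n-1}+s_{n-1}$, $s_n=S\,l_{n-1}$, $l_0=1$, $s_0=0$. **$LS$-sequence of points.** For $n\ge 1$ define $$\varphi_i^{(n+1)}(x)=x+i\gamma^{n+1},\qquad \varphi_{L,j}^{(n+1)}(x)=x+L\gamma^{n+1}+j\gamma^{n+2},$$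 for $1\le i\le L$ and $1\le j\le S-1$ if $S\ge 1$; if $S=0$ only the functions $\varphi_i^{(n+1)}$ with $1\le i\le L-1$ are used. Let $\Lambda_{L,S}^1$ be the list, in increasing order, of the $t_1=L+S$ left endpoints of the intervals of $\rho_{L,S}^1$. If $\Lambda_{L,S}^n=(\xi_1^{(n)},\dots,\xi_{t_n}^{(n)})$, then $\Lambda_{L,S}^{n+1}$ is the ordered list $$\big(\xi_1^{(n)},\dots,\xi_{t_n}^{(n)},\ \varphi_1^{(n+1)}(\xi_1^{(n)}),\dots,\varphi_1^{(n+1)}(\xi_{l_n}^{(n)}),\ \dots,\ \varphi_L^{(n+1)}(\xi_1^{(n)}),\dots,\varphi_L^{(n+1)}(\xi_{l_n}^{(n)}),$$ $$\varphi_{L,1}^{(n+1)}(\xi_1^{(n)}),\dots,\varphi_{L,1}^{(n+1)}(\xi_{l_n}^{(n)}),\ \dots,\ \varphi_{L,S-1}^{(n+1)}(\xi_1^{(n)}),\dots,\varphi_{L,S-1}^{(n+1)}(\xi_{l_n}^{(n)})\big)$$ (if $S=0$ the blocks are those of $\varphi_1^{(n+1)},\dots,\varphi_{L-1}^{(n+1)}$ only). The $LS$-sequence of points $\{\xi_{L,S}^m\}_{m\ge1}$ is the infinite sequence whose first $t_n$ terms are, in order, the list $\Lambda_{L,S}^n$, for every $n\ge 1$. **The set $\mathbb{N}_{L,S}$.** Let $E_{L,S}=\{L,L+1,\dots,L+S-1\}\times\{1,\dots,L+S-1\}$ (empty if $S=0$). For an integer $n\ge 0$ write its representation in base $L+S$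 as $[n]_{L+S}=a_M(n)a_{M-1}(n)\dots a_0(n)$, i.e. $n=\sum_{k=0}^M a_k(n)(L+S)^k$ with $a_k(n)\in\{0,\dots,L+S-1\}$ (with $M=\lfloor\log_{L+S}n\rfloor$ for $n\ge 1$; for $n=0$, $M=0$ and $a_0(0)=0$). $\mathbb{N}_{L,S}$ is the set of all integers $n\ge 0$ such that $(a_k(n),a_{k+1}(n))\notin E_{L,S}$ for all $0\le k\le M-1$, ordered by magnitude. **$LS$-radical inverse function.** For $n\in\mathbb{N}_{L,S}$, $$\phi_{L,S}(n)=\sum_{k=0}^M\tilde a_k(n)\,\gamma^{k+1},$$ where $\tilde a_k(n)=a_k(n)$ if $0\le a_k(n)\le L-1$ and $\tilde a_k(n)=L+\gamma\,(a_k(n)-L)$ if $L\le a_k(n)\le L+S-1$. *)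

(* Defs.v *)
From mathcomp Require Import all_boot all_order all_algebra.
From mathcomp Require Import zify.
Set Implicit Arguments.
Unset Strict Implicit.
Unset Printing Implicit Defensive.
Import Order.TTheory GRing.Theory Num.Theory.
Local Open Scope ring_scope.

(* A half-open interval [a, b[ is the pair (a, b) of its end points, and a
   partition of [0, 1[ is the list of its intervals, from left to right. *)

Definition ilength (R : realFieldType) (J : R * R) : R := J.2 - J.1.

(* The image of K under the positive homothety that maps [0, 1[ onto J. *)
Definition homothetic (R : realFieldType) (J K : R * R) : R * R :=
  (J.1 + ilength J * K.1, J.1 + ilength J * K.2).

Definition is_longest (R : realFieldType) (pi : seq (R * R)) (J : R * R) :
    bool :=
  all (fun K => ilength K <= ilength J) pi.

Definition refine (R : realFieldType) (rho pi : seq (R * R)) : seq (R * R) :=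
  flatten [seq if is_longest pi J then [seq homothetic J K | K <- rho]
               else [:: J] | J <- pi].

Definition is_gamma (R : realFieldType) (L S : nat) (gamma : R) : Prop :=
  0 < gamma /\ L%:R * gamma + S%:R * gamma ^+ 2 = 1.

Definition rhoLS (R : realFieldType) (L S : nat) (gamma : R) :
    seq (R * R) :=
  [seq (i%:R * gamma, i.+1%:R * gamma) | i <- iota 0 L] ++
  [seq (L%:R * gamma + j%:R * gamma ^+ 2,
        L%:R * gamma + j.+1%:R * gamma ^+ 2) | j <- iota 0 S].

Definition LSpartition (R : realFieldType) (L S : nat) (gamma : R) (n : nat) :
    seq (R * R) :=
  iter n (refine (rhoLS L S gamma)) [:: (0, 1)].

Definition total_count (R : realFieldType) (L S : nat) (gamma : R) (n : nat) :
    nat :=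
  size (LSpartition L S gamma n).

Definition long_count (R : realFieldType) (L S : nat) (gamma : R) (n : nat) :
    nat :=
  count (fun J => ilength J == gamma ^+ n) (LSpartition L S gamma n).

(* phi_long and phi_short at p are $\varphi_i^{(p)}$ and
   $\varphi_{L,j}^{(p)}$. *)
Definition phi_long (R : realFieldType) (gamma : R) (p i : nat) (x : R) : R :=
  x + i%:R * gamma ^+ p.

Definition phi_short (R : realFieldType) (L : nat) (gamma : R) (p j : nat)
    (x : R) : R :=
  x + L%:R * gamma ^+ p + j%:R * gamma ^+ p.+1.

(* The map $\Lambda^n \mapsto \Lambda^{n+1}$.  In the comprehensions the outer
   index i (resp. j) varies slowest, which gives the blocks in order. *)
Definition LSextend (R : realFieldType) (L S : nat) (gamma : R) (n : nat)
    (xs : seq R) : seq R :=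
  let ys := take (long_count L S gamma n) xs in
  xs ++
  [seq phi_long gamma n.+1 i x
    | i <- iota 1 (if S == 0%N then L.-1 else L), x <- ys] ++
  [seq phi_short L gamma n.+1 j x | j <- iota 1 S.-1, x <- ys].

(* $\Lambda^n$ for n >= 1; the value at n = 0 is irrelevant. *)
Fixpoint LSpoints (R : realFieldType) (L S : nat) (gamma : R) (n : nat) :
    seq R :=
  match n with
  | 0 => [::]
  | 1 => sort <=%R [seq J.1 | J <- LSpartition L S gamma 1]
  | n'.+1 => LSextend L S gamma n' (LSpoints L S gamma n')
  end.

(* xi is indexed from 1; xi 0 is unconstrained. *)
Definition is_LSsequence (R : realFieldType) (L S : nat) (gamma : R)
    (xi : nat -> R) : Prop :=
  forall n, (1 <= n)%N ->
    [seq xi m | m <- iota 1 (total_count L S gamma n)] = LSpoints L S gamma n.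

Definition digit (b n k : nat) : nat := ((n %/ b ^ k) %% b)%N.

(* The position M of the leading digit of n in base b; it is 0 for n = 0. *)
Definition top_digit (b n : nat) : nat := trunc_log b n.

Definition in_ELS (L S : nat) (p : nat * nat) : bool :=
  (L <= p.1 < L + S)%N && (1 <= p.2 < L + S)%N.

Definition in_NLS (L S n : nat) : bool :=
  [forall k : 'I_(top_digit (L + S) n),
     ~~ in_ELS L S (digit (L + S) n k, digit (L + S) n k.+1)].

(* e 1 < e 2 < e 3 < ... lists exactly the elements of P; e 0 is
   unconstrained. *)
Definition increasing_enumeration (P : pred nat) (e : nat -> nat) : Prop :=
  (forall m m', (1 <= m)%N -> (m < m')%N -> (e m < e m')%N) /\
  (forall n, P n <-> exists m, (1 <= m)%N /\ e m = n).

Definition digit_weight (R : realFieldType) (L : nat) (gamma : R) (a : nat) :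
    R :=
  if (a < L)%N then a%:R else L%:R + gamma * (a - L)%:R.

Definition LSradical_inverse (R : realFieldType) (L S : nat) (gamma : R)
    (n : nat) : R :=
  \sum_(k < (top_digit (L + S) n).+1)
     digit_weight L gamma (digit (L + S) n k) * gamma ^+ k.+1.

(* The sequences described by increasing_enumeration and is_LSsequence
   exist. *)

Lemma increasing_enumeration_ex (P : pred nat) :
  (forall n, exists m, (n <= m)%N && P m) ->
  exists e, increasing_enumeration P e.
Proof.
move=> infP; pose next n := ex_minn (infP n).
have nextP n : (n <= next n)%N && P (next n) by rewrite /next; case: ex_minnP.
have next_min n k : (n <= k)%N -> P k -> (next n <= k)%N.
  by rewrite /next => le_nk Pk; case: ex_minnP => m _; apply; rewrite le_nk.
pose e m := iter m.-1 (fun n => next n.+1) (next 0).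
have eS m : (1 <= m)%N -> e m.+1 = next (e m).+1 by case: m.
have e_lt m : (1 <= m)%N -> (e m < e m.+1)%N.
  by move=> /eS ->; case/andP: (nextP (e m).+1).
have eP m : P (e m).
  by rewrite /e; case: m.-1 => [|k] /=; [case/andP: (nextP 0) |
    case/andP: (nextP (iter k (fun n => next n.+1) (next 0)).+1)].
have e_ge m : (m <= e m.+1)%N.
  by elim: m => // m IHm; apply: leq_ltn_trans IHm (e_lt _ _).
exists e; split=> [m m' m_gt0|n].
  elim: m' => // m' IHm; rewrite ltnS leq_eqVlt => /predU1P[<-|lt_mm'].
    exact: e_lt.
  apply: ltn_trans (IHm lt_mm') (e_lt _ _).
  exact: leq_ltn_trans (leq0n m) lt_mm'.
split=> [Pn|[m [_ <-]]]; last exact: eP.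
have [m /andP[m_gt0 le_n_e] m_min] :
    exists2 m, (1 <= m)%N && (n <= e m)%N
             & forall k, (1 <= k)%N && (n <= e k)%N -> (m <= k)%N.
  have ex_m : exists m, (1 <= m)%N && (n <= e m)%N by exists n.+1; exact: e_ge.
  by exists (ex_minn ex_m); case: ex_minnP.
exists m; split=> //; apply/eqP; rewrite eqn_leq le_n_e andbT.
case: m m_gt0 {le_n_e} m_min => // -[|m] _ m_min; first exact: next_min.
rewrite eS //; apply: next_min => //; rewrite ltnNge; apply/negP=> le_n_e.
by have:= m_min m.+1; rewrite le_n_e ltnn => /(_ isT).
Qed.

Lemma in_NLS_infinite (L S : nat) : (1 <= L)%N -> (2 <= L + S)%N ->
  forall n, exists m, (n <= m)%N && in_NLS L S m.
Proof.
move=> L_gt0 b_gt1 n; exists ((L + S) ^ n)%N.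
rewrite (ltnW (ltn_expl n b_gt1)) /=.
apply/forallP=> -[k /=]; rewrite /top_digit trunc_expnK // => lt_kn.
rewrite /in_ELS /digit /= -(subnK (ltnW lt_kn)) expnD.
rewrite mulnK ?expn_gt0 ?(ltnW b_gt1) //.
by rewrite -(subnSK lt_kn) expnS modnMr leqn0 -(negbK (L == 0)%N) -lt0n L_gt0.
Qed.

Lemma LSsequence_ex (R : realFieldType) (L S : nat) (gamma : R) :
  (1 <= L)%N -> (2 <= L + S)%N -> is_gamma L S gamma ->
  exists xi, is_LSsequence L S gamma xi.
Proof.
move=> L_gt0 b_gt1 [g_gt0 Eg].
have g_lt1 : gamma < 1.
  rewrite ltNge; apply/negP=> g_ge1.
  suff: 2%:R <= (1 : R) by rewrite lern1.
  rewrite -[leRHS]Eg; apply: (@le_trans _ _ (L + S)%:R); first by rewrite ler_nat.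
  rewrite natrD; apply: lerD; rewrite ler_peMr ?ler0n ?exprn_ege1 //.
pose good n pi :=
  all (fun J => (ilength J == gamma ^+ n) || (ilength J == gamma ^+ n.+1)) pi
  && has (fun J : R * R => ilength J == gamma ^+ n) pi.
have longE n pi J : good n pi -> J \in pi ->
    is_longest pi J = (ilength J == gamma ^+ n).
  case/andP=> /allP pi_all /hasP[K piK /eqP lK] piJ.
  apply/allP/eqP => [/(_ _ piK)|-> J' /pi_all /orP[] /eqP -> //].
    rewrite lK => le_nJ; case/orP: (pi_all _ piJ) => /eqP // lJ.
    by move: le_nJ; rewrite lJ exprS ler_pMl ?exprn_gt0 // leNgt g_lt1.
  by rewrite exprS ger_pMl ?exprn_gt0 // ltW.
pose rho := rhoLS L S gamma.
have rho_sz : size rho = (L + S)%N by rewrite size_cat !size_map !size_iota.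
have rho_len J : J \in rho -> ilength J = gamma \/ ilength J = gamma ^+ 2.
  rewrite mem_cat /ilength => /orP[] /mapP[i _ ->] /=; [left|right].
    by rewrite -mulrBl -natrB ?leqnSn // subSnn mul1r.
  by rewrite opprD addrACA subrr add0r -mulrBl -natrB ?leqnSn // subSnn mul1r.
have hom_len (J K : R * R) : ilength (homothetic J K) = ilength J * ilength K.
  by rewrite /ilength /homothetic /= opprD addrACA subrr add0r -mulrBr.
have good_refine n pi : good n pi -> good n.+1 (refine rho pi).
  move=> pi_good; have longP := longE _ _ _ pi_good.
  have [/allP pi_all /hasP[K piK /eqP lK]] := andP pi_good; apply/andP; split.
    apply/allP=> J /flattenP[_ /mapP[J' piJ' ->]]; rewrite longP //.
    case: ifPn => [/eqP lJ' /mapP[J'' /rho_len lJ'' ->] | nJ'].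
      by rewrite hom_len lJ'; case: lJ'' => ->;
        rewrite -?exprSr -?exprD ?addn2 eqxx ?orbT.
    rewrite inE => /eqP->; move: (pi_all _ piJ').
    by rewrite (negPf nJ') /= => ->.
  have rho0 : (0%:R * gamma, 1%:R * gamma) \in rho.
    by rewrite mem_cat map_f // mem_iota.
  apply/hasP; exists (homothetic K (0%:R * gamma, 1%:R * gamma)).
    apply/flattenP; exists [seq homothetic K J | J <- rho]; last exact: map_f.
    by apply/mapP; exists K => //; rewrite longP // lK eqxx.
  by rewrite hom_len lK /ilength /= mul0r mul1r subr0 exprSr.
have good_part n : good n (LSpartition L S gamma n).
  elim: n => [|n /good_refine //].
  by rewrite /good /= /ilength subr0 expr0 eqxx.
have tS n : (total_count L S gamma n.+1 + long_count L S gamma n =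
             total_count L S gamma n + (L + S) * long_count L S gamma n)%N.
  rewrite /total_count /long_count [LSpartition L S gamma n.+1]/= -/rho.
  rewrite -/(LSpartition L S gamma n).
  set pi := LSpartition L S gamma n; rewrite /refine.
  have /eq_in_map-> : {in pi, forall J, (if is_longest pi J
      then [seq homothetic J K | K <- rho] else [:: J]) =
      (if ilength J == gamma ^+ n
      then [seq homothetic J K | K <- rho] else [:: J])}.
    by move=> J piJ; rewrite (longE n).
  elim: (pi) => [|J s IHs] /=; first by rewrite muln0.
  rewrite size_cat addnACA {}IHs addnACA mulnDr.
  case: ifP => _ /=.
    by rewrite size_map rho_sz muln1; lia.
  by rewrite muln0; lia.
have l_gt0 n : (0 < long_count L S gamma n)%N.
  by rewrite -has_count; case/andP: (good_part n).
have l_le n : (long_count L S gamma n <= total_count L S gamma n)%N.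
  exact: count_size.
have szL n : size (LSpoints L S gamma n.+1) = total_count L S gamma n.+1.
  elim: n => [|n IHn]; first by rewrite size_sort size_map.
  have {IHn}: size (LSextend L S gamma n.+1 (LSpoints L S gamma n.+1)) =
          total_count L S gamma n.+2; last by [].
  rewrite /LSextend !size_cat !size_allpairs !size_iota size_takel ?IHn //.
  have:= tS n.+1; case: (S) b_gt1 => [|S'] _ /=; last nia.
  by case: (L) L_gt0 => // L' _ /=; nia.
have t_ge n : (n < total_count L S gamma n)%N.
  elim: n => // n IHn; have := tS n; have := l_gt0 n.
  have : (2 * long_count L S gamma n <= (L + S) * long_count L S gamma n)%N.
    by rewrite leq_mul2r b_gt1 orbT.
  lia.
have pre n k : exists s,
    LSpoints L S gamma (n + k).+1 = LSpoints L S gamma n.+1 ++ s.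
  elim: k => [|k [s IHk]]; first by rewrite addn0; exists [::]; rewrite cats0.
  rewrite addnS; have -> : LSpoints L S gamma (n + k).+2 =
    LSextend L S gamma (n + k).+1 (LSpoints L S gamma (n + k).+1) by [].
  by rewrite /LSextend {1}IHk -catA; eexists.
exists (fun m => nth 0 (LSpoints L S gamma m) m.-1) => -[//|n] _.
rewrite -(mkseq_nth 0 (LSpoints L S gamma n.+1)) szL /mkseq -[1%N]/(1 + 0)%N.
rewrite iotaDl -map_comp; apply/eq_in_map => m.
rewrite mem_iota add0n => /andP[_ lt_m]; rewrite [LHS]/comp add1n succnK.
case: (leqP m n) => [/subnKC E|/ltnW/subnKC E].
  have [s] := pre m (n - m)%N; rewrite E => ->.
  by rewrite nth_cat szL (ltn_trans _ (t_ge _)).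
have [s] := pre n (m - n)%N; rewrite E => ->.
by rewrite nth_cat szL lt_m.
Qed.

(* Main.v *)
Require Import Defs.
From mathcomp Require Import all_boot all_order all_algebra.
From mathcomp Require Import reals.
From mathcomp Require Import zify.
Set Implicit Arguments.
Unset Strict Implicit.
Unset Printing Implicit Defensive.
Import Order.TTheory GRing.Theory Num.Theory.
Local Open Scope ring_scope.

(** A digit [a >= L] must be followed by the more significant digit [0], so for
    [x < b ^ n.+1], [b = L + S] and [0 < a < b], the number [x + a b ^ n.+1] is
    admissible iff [x] is admissible and [x < L b ^ n].  Hence the admissible
    numbers below [b ^ n.+2] are those below [b ^ n.+1] followed, for
    [a = 1, ..., b - 1], by the translates by [a b ^ n.+1] of an initial segment.
    This is the block structure of $\Lambda^{n+2}$: the lengths of the segments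
    obey the recurrence of the number of long intervals, and the radical inverse
    turns the translation by [a b ^ n.+1] into $\varphi_a$ for [a <= L] and
    $\varphi_{L,a-L}$ for [a > L]. *)

(** * Interval lengths and the recurrences for the interval counts *)

Lemma is_gamma_lt1 (R : realFieldType) (L S : nat) (gamma : R) :
  (2 <= L + S)%N -> is_gamma L S gamma -> gamma < 1.
Proof.
move=> b_gt1 [g_gt0 Eg]; rewrite ltNge; apply/negP=> g_ge1.
suff: 2%:R <= (1 : R) by rewrite lern1.
rewrite -[leRHS]Eg; apply: (@le_trans _ _ (L + S)%:R); first by rewrite ler_nat.
by rewrite natrD; apply: lerD; rewrite ler_peMr ?ler0n ?exprn_ege1.
Qed.

Lemma ilength_homothetic (R : realFieldType) (J K : R * R) :
  ilength (homothetic J K) = ilength J * ilength K.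
Proof. by rewrite /ilength /= opprD addrACA subrr add0r -mulrBr. Qed.

Lemma map_ilength_rhoLS (R : realFieldType) (L S : nat) (gamma : R) :
  [seq ilength K | K <- rhoLS L S gamma] = nseq L gamma ++ nseq S (gamma ^+ 2).
Proof.
have map_cst (T : Type) (f : nat -> T) c m :
    (forall i, f i = c) -> map f (iota 0 m) = nseq m c.
  by move=> fE; elim: m 0%N => //= m IHm k; rewrite fE IHm.
rewrite map_cat -!map_comp; congr (_ ++ _); apply: map_cst => i; rewrite /ilength /=.
  by rewrite -mulrBl -natrB // subSnn mul1r.
by rewrite opprD addrACA subrr add0r -mulrBl -natrB // subSnn mul1r.
Qed.

Section Partitions.
Variables (R : realFieldType) (L S : nat) (gamma : R).
Hypotheses (L_gt0 : (1 <= L)%N) (b_gt1 : (2 <= L + S)%N).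
Hypothesis gP : is_gamma L S gamma.

Let g_gt0 : 0 < gamma := gP.1.
Let g_lt1 : gamma < 1 := is_gamma_lt1 b_gt1 gP.

Let eqg i j : (gamma ^+ i == gamma ^+ j) = (i == j).
Proof.
have g_lt k l : (k < l)%N -> gamma ^+ l < gamma ^+ k.
  by move=> lt_kl; rewrite ltr_iXn2l.
apply/eqP/eqP => [E|-> //]; apply/eqP.
by case: ltngtP => // /g_lt; rewrite E ltxx.
Qed.

(** The invariant of [LSpartition]. The [has] clause guarantees that the maximal length is
    [gamma ^+ n], not [gamma ^+ n.+1], so that the longest intervals are exactly the long ones. *)
Definition level (n : nat) (pi : seq (R * R)) :=
  all (fun J => ilength J \in [:: gamma ^+ n; gamma ^+ n.+1]) pi
  && has (fun J => ilength J == gamma ^+ n) pi.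

Lemma level_longest n pi J : level n pi -> J \in pi ->
  is_longest pi J = (ilength J == gamma ^+ n).
Proof.
case/andP=> /allP pi_all /hasP[K piK /eqP lK] piJ.
have le_n : gamma ^+ n.+1 <= gamma ^+ n by rewrite exprS ger_pMl ?exprn_gt0 // ltW.
apply/allP/eqP => [/(_ _ piK)|-> J' /pi_all].
  have:= pi_all _ piJ; rewrite lK !inE => /orP[] /eqP -> //.
  by rewrite exprS ler_pMl ?exprn_gt0 // leNgt g_lt1.
by rewrite !inE => /orP[] /eqP ->.
Qed.

(** Being longest depends on the whole of [pi]; a test on the length of [J] alone does not, which
    makes induction along the list possible when counting. *)
Lemma level_refineE n pi : level n pi ->
  refine (rhoLS L S gamma) pi =
  flatten [seq if ilength J == gamma ^+ n
               then [seq homothetic J K | K <- rhoLS L S gamma]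
               else [:: J] | J <- pi].
Proof.
move=> pi_lv; congr flatten; apply/eq_in_map => J piJ.
by rewrite (level_longest pi_lv).
Qed.

Let len_hom n J : ilength J = gamma ^+ n ->
  [seq ilength K | K <- [seq homothetic J K | K <- rhoLS L S gamma]] =
  nseq L (gamma ^+ n.+1) ++ nseq S (gamma ^+ n.+2).
Proof.
move=> lJ; rewrite -map_comp.
rewrite (@eq_map _ _ _ ( *%R (gamma ^+ n) \o @ilength R)); last first.
  by move=> K /=; rewrite ilength_homothetic lJ.
by rewrite map_comp map_ilength_rhoLS map_cat !map_nseq -exprSr -exprD addn2.
Qed.

Lemma level_refine n pi : level n pi -> level n.+1 (refine (rhoLS L S gamma) pi).
Proof.
move=> pi_lv; rewrite (level_refineE pi_lv).
have [/allP pi_all /hasP[K piK /eqP lK]] := andP pi_lv; apply/andP; split.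
  apply/allP=> J /flattenP[_ /mapP[J' piJ' ->]].
  case: ifPn => [/eqP lJ' piJ|nJ'].
    have:= map_f (@ilength R) piJ; rewrite (len_hom lJ') mem_cat !inE.
    by rewrite !mem_nseq => /orP[] /andP[_ ->]; rewrite ?orbT.
  by rewrite inE => /eqP->; move: (pi_all _ piJ'); rewrite !inE (negPf nJ') /= => ->.
(* Since [L >= 1], subdividing a long interval produces a long interval of the next level. *)
have /mapP[J KJ lJ] : gamma ^+ n.+1 \in
    [seq ilength J | J <- [seq homothetic K J | J <- rhoLS L S gamma]].
  by rewrite (len_hom lK) mem_cat mem_nseq L_gt0 eqxx.
apply/hasP; exists J; last by rewrite -lJ.
apply/flattenP; eexists; last exact: KJ.
by apply/mapP; exists K; rewrite // lK eqxx.
Qed.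

Lemma level_LSpartition n : level n (LSpartition L S gamma n).
Proof.
elim: n => [|n]; last exact: level_refine.
by rewrite /level /= /ilength !inE subr0 expr0 eqxx.
Qed.

(** Each long interval is replaced by [L + S] pieces. The additive form avoids truncated
    subtraction. *)
Lemma total_countS n :
  (total_count L S gamma n.+1 + long_count L S gamma n =
   total_count L S gamma n + (L + S) * long_count L S gamma n)%N.
Proof.
rewrite /total_count /long_count [LSpartition L S gamma n.+1]/=.
rewrite -/(LSpartition L S gamma n) (level_refineE (level_LSpartition n)).
elim: (LSpartition L S gamma n) => [|J s IHs] /=; first by rewrite muln0.
rewrite size_cat; case: eqP => [lJ|_] /=; last by lia.
rewrite -(size_map (@ilength R)) (len_hom lJ) size_cat !size_nseq; lia.
Qed.

(** This is $l_{n+1} = L l_n + s_n$ with $s_n = t_n - l_n$: a long interval yields [L] long ones,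
    and a short one is kept and becomes long at the next level. *)
Lemma long_countS n :
  (long_count L S gamma n.+1 + long_count L S gamma n =
   total_count L S gamma n + L * long_count L S gamma n)%N.
Proof.
rewrite /total_count /long_count [LSpartition L S gamma n.+1]/=.
have lv := level_LSpartition n.
rewrite -/(LSpartition L S gamma n) (level_refineE lv).
case/andP: lv => + _.
elim: (LSpartition L S gamma n) => [|J s IHs] /=; first by rewrite muln0.
case/andP=> lJ /IHs{}IHs; rewrite count_cat.
move: lJ; rewrite !inE; case: eqP => [lJ _|_ /eqP lJ] /=; last first.
  by rewrite lJ eqxx; lia.
have -> : count (fun K : R * R => ilength K == gamma ^+ n.+1)
    [seq homothetic J K | K <- rhoLS L S gamma] = L.
  rewrite -(count_map (@ilength R) (pred1 (gamma ^+ n.+1))) (len_hom lJ).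
  by rewrite count_cat !count_nseq /= !eqg eqxx (gtn_eqF (ltnSn _)); lia.
lia.
Qed.

Lemma long_count0 : long_count L S gamma 0 = 1%N.
Proof. by rewrite /long_count /= /ilength subr0 expr0 eqxx. Qed.

Lemma LSpoints1E :
  LSpoints L S gamma 1 = [seq digit_weight L gamma a * gamma | a <- iota 0 (L + S)].
Proof.
have lP1 : LSpartition L S gamma 1 = [seq homothetic (0, 1) K | K <- rhoLS L S gamma].
  rewrite /= (level_refineE (level_LSpartition 0)) /= /ilength subr0 expr0 eqxx.
  by rewrite cats0.
have wE : [seq digit_weight L gamma a * gamma | a <- iota 0 (L + S)] =
    [seq J.1 | J <- LSpartition L S gamma 1].
  rewrite lP1 iotaD !map_cat -!map_comp add0n -[X in iota X S]addn0 iotaDl.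
  rewrite -map_comp.
  congr (_ ++ _); apply/eq_in_map => i; rewrite mem_iota /= /digit_weight
    /ilength subr0 mul1r add0r.
    by move=> ->.
  move=> _; rewrite ltnNge leq_addr /= addKn.
  by rewrite expr2 mulrDl mulrAC [gamma * _ * _]mulrC mulrA.
(* Sorting changes nothing, because [digit_weight] increases with the digit. *)
rewrite wE; apply: sort_le_id; rewrite -wE sorted_map.
apply: sub_sorted (iota_ltn_sorted 0 _) => i j lt_ij; rewrite /relpre /=.
rewrite ler_pM2r // /digit_weight.
case: ltnP => [lt_iL|le_Li]; case: ltnP => [lt_jL|le_Lj].
- by rewrite ler_nat ltnW.
- apply: (@le_trans _ _ L%:R); first by rewrite ler_nat ltnW.
  by rewrite lerDl mulr_ge0 // ltW.
- lia.
- by rewrite lerD2l ler_pM2l // ler_nat leq_sub2r // ltnW.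
Qed.
End Partitions.

(** * Digits and admissible numbers *)

Lemma digit_eq0 (b n x k : nat) : (0 < b)%N -> (x < b ^ n)%N -> (n <= k)%N ->
  digit b x k = 0%N.
Proof.
move=> b_gt0 lt_x le_nk; rewrite /digit divn_small ?mod0n //.
exact: leq_trans lt_x (leq_pexp2l b_gt0 le_nk).
Qed.

Lemma digitMD (b n x a k : nat) : (x < b ^ n)%N -> (a < b)%N ->
  digit b (x + a * b ^ n) k =
  if (k < n)%N then digit b x k else if k == n then a else 0%N.
Proof.
move=> lt_x lt_ab; have b_gt0 : (0 < b)%N by case: b lt_ab {lt_x}.
case: ltngtP => [lt_kn|lt_nk|->].
- rewrite /digit -(subnK lt_kn) addnS -addSn expnD expnS addnC.
  rewrite mulnA divnMDl ?expn_gt0 ?b_gt0 //.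
  by rewrite mulnCA mulnC modnMDl.
- apply: digit_eq0 lt_nk => //; rewrite expnS.
  apply: (@leq_trans (b ^ n + a * b ^ n)); first by rewrite ltn_add2r.
  by rewrite -mulSn leq_mul2r lt_ab orbT.
- rewrite /digit addnC divnMDl ?expn_gt0 ?b_gt0 //.
  by rewrite divn_small // addn0 modn_small.
Qed.

Section Admissible.
Variables (L S : nat).
Hypothesis b_gt1 : (2 <= L + S)%N.
Local Notation b := (L + S)%N.
Let b_gt0 : (0 < b)%N := ltnW b_gt1.

Lemma in_NLSP x :
  reflect (forall k, ~~ in_ELS L S (digit b x k, digit b x k.+1)) (in_NLS L S x).
Proof.
apply: (iffP forallP) => [ok k|ok k]; last exact: ok.
have [lt_k|le_k] := ltnP k (top_digit b x); first exact: (ok (Ordinal lt_k)).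
rewrite /in_ELS /= (@digit_eq0 b (top_digit b x).+1 x k.+1) ?andbF //.
exact: trunc_log_ltn.
Qed.

Lemma in_NLS_digit x : (x < b)%N -> in_NLS L S x.
Proof.
move=> lt_x; apply/in_NLSP => k.
by rewrite /in_ELS /= (@digit_eq0 b 1 x k.+1) ?andbF // expn1.
Qed.

Lemma in_NLS_MD n x a : (x < b ^ n.+1)%N -> (0 < a < b)%N ->
  in_NLS L S (x + a * b ^ n.+1) = in_NLS L S x && (x < L * b ^ n)%N.
Proof.
move=> lt_x /andP[a_gt0 lt_a].
have dE := digitMD _ lt_x lt_a.
have -> : (x < L * b ^ n)%N = (digit b x n < L)%N.
  rewrite /digit modn_small ?ltn_divLR ?expn_gt0 ?b_gt0 //.
  by rewrite -expnS.
apply/in_NLSP/andP => [ok|[/in_NLSP ok lt_L] k].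
  split; last first.
    (* At position [n] the pair is the digit [n] of [x] followed by [a > 0], which forces that digit
       below [L]. *)
    have:= ok n; rewrite !dE ltnSn ltnn eqxx /in_ELS /= a_gt0 lt_a andbT.
    by rewrite ltn_pmod // !andbT -ltnNge.
  apply/in_NLSP => k; have [lt_kn|le_nk] := ltnP k n.
    by have:= ok k; rewrite !dE !ltnS lt_kn (ltnW lt_kn).
  by rewrite /in_ELS /= (digit_eq0 b_gt0 lt_x (_ : (n < k.+1)%N)) ?andbF.
rewrite !dE !ltnS eqSS; case: (ltngtP k n) => [_|_|->]; first exact: ok.
  by rewrite /in_ELS /= andbF.
by rewrite /in_ELS /= leqNgt lt_L.
Qed.

Definition NLS_below (m : nat) : seq nat := [seq x <- iota 0 m | in_NLS L S x].

Lemma NLS_belowP m x : (x \in NLS_below m) = in_NLS L S x && (x < m)%N.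
Proof. by rewrite mem_filter mem_iota. Qed.

Lemma NLS_belowD m n : exists s, NLS_below (m + n) = NLS_below m ++ s.
Proof. by eexists; rewrite /NLS_below iotaD filter_cat. Qed.

Let NLS_block n a : (0 < a < b)%N ->
  [seq x <- iota (a * b ^ n.+1) (b ^ n.+1) | in_NLS L S x] =
  [seq (x + a * b ^ n.+1)%N | x <- NLS_below (L * b ^ n)].
Proof.
move=> lt_a; rewrite -[X in iota X]addn0 iotaDl filter_map.
rewrite (@eq_map _ _ (addn (a * b ^ n.+1)) (addn^~ (a * b ^ n.+1))%N); last first.
  by move=> x /=; rewrite addnC.
congr map; transitivity
    [seq x <- iota 0 (b ^ n.+1) | in_NLS L S x && (x < L * b ^ n)%N].
  apply/eq_in_filter => x; rewrite mem_iota => lt_x /=.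
  by rewrite addnC in_NLS_MD.
(* The range splits as $b^{n+1} = L b^n + S b^n$; the second part contributes nothing. *)
rewrite expnS mulnDl iotaD filter_cat -[RHS]cats0; congr (_ ++ _).
  by apply/eq_in_filter => x; rewrite mem_iota => /andP[_ ->]; rewrite andbT.
rewrite (@eq_in_filter _ _ pred0) ?filter_pred0 // => x.
by rewrite mem_iota add0n => /andP[le_x _] /=; rewrite ltnNge le_x andbF.
Qed.

(** The multiplier is kept general for two uses: [c.+1 = L + S] gives all admissible numbers of the
    next level, and [c.+1 = L] the initial segment that the next level will translate. *)
Lemma NLS_belowM n c : (c < b)%N ->
  NLS_below (c.+1 * b ^ n.+1) =
  NLS_below (b ^ n.+1) ++
  [seq (x + a * b ^ n.+1)%N | a <- iota 1 c, x <- NLS_below (L * b ^ n)].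
Proof.
elim: c => [|c IHc] lt_c; first by rewrite mul1n cats0.
rewrite mulSn addnC {1}/NLS_below iotaD filter_cat -/(NLS_below _).
rewrite IHc 1?ltnW // add0n NLS_block //.
have -> : iota 1 c.+1 = iota 1 c ++ [:: c.+1] by rewrite -[c.+1]addn1 iotaD add1n addn1.
by rewrite map_cat flatten_cat catA /= cats0.
Qed.
End Admissible.

(** * The radical inverse and translations by a leading digit *)

Lemma digit_weight0 (R : realFieldType) (L : nat) (gamma : R) : (1 <= L)%N ->
  digit_weight L gamma 0 = 0.
Proof. by rewrite /digit_weight => ->. Qed.

Lemma LSradical_inverseE (R : realFieldType) (L S : nat) (gamma : R) (n x : nat) :
  (1 <= L)%N -> (2 <= L + S)%N -> (x < (L + S) ^ n)%N ->
  LSradical_inverse L S gamma x =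
  \sum_(k < n) digit_weight L gamma (digit (L + S) x k) * gamma ^+ k.+1.
Proof.
move=> L_gt0 b_gt1 lt_x; have b_gt0 := ltnW b_gt1.
pose F k := digit_weight L gamma (digit (L + S) x k) * gamma ^+ k.+1.
have widen m N : (x < (L + S) ^ m)%N -> (m <= N)%N ->
    \sum_(k < m) F k = \sum_(k < N) F k.
  move=> lt_m le_mN; rewrite -!(big_mkord xpredT) (big_cat_nat _ le_mN) //=.
  rewrite [X in _ = _ + X]big_nat_cond [X in _ = _ + X]big1 ?addr0 // => k.
  rewrite andbT => /andP[le_mk _].
  by rewrite /F (digit_eq0 b_gt0 lt_m) // digit_weight0 // mul0r.
(* Leading zeros have weight 0, so both sums can be extended to a common length. *)
rewrite (widen n (n + (top_digit (L + S) x).+1)%N) ?leq_addr //.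
by apply: widen; rewrite ?leq_addl // trunc_log_ltn.
Qed.

Lemma LSradical_inverseMD (R : realFieldType) (L S : nat) (gamma : R)
    (n x a : nat) :
  (1 <= L)%N -> (2 <= L + S)%N -> (x < (L + S) ^ n)%N -> (a < L + S)%N ->
  LSradical_inverse L S gamma (x + a * (L + S) ^ n) =
  LSradical_inverse L S gamma x + digit_weight L gamma a * gamma ^+ n.+1.
Proof.
move=> L_gt0 b_gt1 lt_x lt_a.
rewrite (@LSradical_inverseE _ _ _ _ n.+1) //; last first.
  rewrite expnS; apply: (@leq_trans ((L + S) ^ n + a * (L + S) ^ n)).
    by rewrite ltn_add2r.
  by rewrite -mulSn leq_mul2r lt_a orbT.
rewrite (@LSradical_inverseE _ _ _ _ n x) // big_ord_recr /=.
rewrite digitMD // ltnn eqxx; congr (_ + _); apply: eq_bigr => k _.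
by rewrite digitMD // ltn_ord.
Qed.

(** * Enumeration, block sizes and comparison of the two sequences *)

Lemma increasing_enumeration_filter (P : pred nat) (e : nat -> nat) (m : nat) :
  increasing_enumeration P e -> (1 <= m)%N ->
  [seq x <- iota 0 (e m) | P x] = [seq e k | k <- iota 1 m.-1].
Proof.
move=> [e_lt eP] m_gt0; apply: lt_sorted_eq => [||x].
- exact/(sorted_filter ltn_trans)/iota_ltn_sorted.
- apply: (homo_sorted_in (P := [pred k | (1 <= k)%N]) (e := ltn)).
  + by move=> i j /= i_gt0 _; apply: e_lt.
  + by apply/allP => k; rewrite mem_iota => /andP[].
  + exact: iota_ltn_sorted.
rewrite mem_filter mem_iota /= add0n; apply/andP/mapP => [[/eP[k [k_gt0 <-]] lt_e]|].
  exists k => //; rewrite mem_iota k_gt0 add1n prednK // ltnNge.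
  apply/negP; rewrite leq_eqVlt => /predU1P[E|/(e_lt _ _ m_gt0)].
    by rewrite E ltnn in lt_e.
  by rewrite ltnNge ltnW.
case=> k; rewrite mem_iota add1n prednK // => /andP[k_gt0 lt_km] ->.
by split; [apply/eP; exists k | apply: e_lt].
Qed.

(** The two counts are proved together, since [NLS_belowM] expresses each of them at the next level
    through both. *)
Lemma size_NLS_below (R : realFieldType) (L S : nat) (gamma : R) (n : nat) :
  (1 <= L)%N -> (2 <= L + S)%N -> is_gamma L S gamma ->
  size (NLS_below L S ((L + S) ^ n.+1)) = total_count L S gamma n.+1 /\
  size (NLS_below L S (L * (L + S) ^ n)) = long_count L S gamma n.+1.
Proof.
move=> L_gt0 b_gt1 gP; have b_gt0 := ltnW b_gt1.
have t_rec k := total_countS L_gt0 b_gt1 gP k.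
have l_rec k := long_countS L_gt0 b_gt1 gP k.
elim: n => [|n [IHt IHl]].
  have all_in k : (k <= L + S)%N -> size (NLS_below L S k) = k.
    move=> le_k; rewrite size_filter -[RHS](size_iota 0); apply/eqP.
    rewrite -all_count; apply/allP => x; rewrite mem_iota => /andP[_ lt_x].
    exact/in_NLS_digit/(leq_trans lt_x).
  rewrite expn1 muln1 !all_in ?leq_addr //.
  (* From $t_0 = l_0 = 1$ the recurrences give $t_1 = L + S$ and $l_1 = L$. *)
  have:= (t_rec 0%N, l_rec 0%N); rewrite long_count0 // => -[].
  by have -> : total_count L S gamma 0 = 1%N by []; lia.
have sizeM c : (0 < c <= L + S)%N ->
    (size (NLS_below L S (c * (L + S) ^ n.+1)) + long_count L S gamma n.+1 =
     total_count L S gamma n.+1 + c * long_count L S gamma n.+1)%N.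
  case: c => // c lt_c; rewrite NLS_belowM // size_cat size_allpairs size_iota.
  by rewrite IHt IHl; lia.
have := t_rec n.+1; have := l_rec n.+1; rewrite expnS.
have := sizeM L; have := sizeM (L + S)%N; rewrite L_gt0 b_gt0 leqnn leq_addr.
by move=> /(_ isT) ? /(_ isT) ? ? ?; split; lia.
Qed.

Lemma LSpointsE (R : realFieldType) (L S : nat) (gamma : R) (n : nat) :
  (1 <= L)%N -> (2 <= L + S)%N -> is_gamma L S gamma ->
  LSpoints L S gamma n.+1 =
  [seq LSradical_inverse L S gamma x | x <- NLS_below L S ((L + S) ^ n.+1)].
Proof.
move=> L_gt0 b_gt1 gP; have b_gt0 := ltnW b_gt1.
elim: n => [|n IHn].
  rewrite (LSpoints1E L_gt0 b_gt1 gP) expn1 /NLS_below.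
  rewrite (_ : filter _ _ = iota 0 (L + S)); last first.
    by apply/all_filterP/allP => x; rewrite mem_iota => /andP[_ /(in_NLS_digit b_gt1)].
  apply/eq_in_map => a; rewrite mem_iota => /andP[_ lt_a].
  by rewrite (@LSradical_inverseE _ _ _ _ 1) ?expn1 // big_ord1 /digit divn1 modn_small.
have -> : LSpoints L S gamma n.+2 =
  LSextend L S gamma n.+1 (LSpoints L S gamma n.+1) by [].
rewrite {}IHn /LSextend.
(* The admissible numbers below $L b^n$ form a prefix of those below $b^{n+1}$, of length $l_{n+1}$:
   exactly what [take] selects in [LSextend]. *)
have [s Es] := NLS_belowD L S (L * (L + S) ^ n) (S * (L + S) ^ n).
have [_ szl] := size_NLS_below n L_gt0 b_gt1 gP.
rewrite -map_take {2 3}expnS mulnDl Es take_size_cat //.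
have := @NLS_belowM L S b_gt1 n (L + S).-1; rewrite ltn_predL prednK // -expnS.
move=> /(_ b_gt0) ->; rewrite map_cat; congr (_ ++ _); rewrite map_allpairs; apply/esym.
set N := NLS_below L S (L * _).
transitivity [seq y + digit_weight L gamma a * gamma ^+ n.+2
  | a <- iota 1 (L + S).-1, y <- [seq LSradical_inverse L S gamma x | x <- N]].
  rewrite (allpairs_mapr _ (fun=> LSradical_inverse L S gamma)).
  apply/eq_in_allpairs => a x; rewrite mem_iota => lt_a.
  rewrite NLS_belowP => /andP[_ lt_x]; rewrite LSradical_inverseMD //.
    by apply: leq_trans lt_x _; rewrite expnS leq_mul2r leq_addr orbT.
  by move: lt_a; lia.
(* The digit [a = L] is included: its weight $L + \gamma \cdot 0$ agrees with the long formula. *)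
have longE a y : (a <= L)%N ->
    y + digit_weight L gamma a * gamma ^+ n.+2 = phi_long gamma n.+2 a y.
  rewrite /phi_long /digit_weight leq_eqVlt => /predU1P[->|-> //].
  by rewrite ltnn subnn mulr0 addr0.
have shortE j y : y + digit_weight L gamma (L + j) * gamma ^+ n.+2 =
    phi_short L gamma n.+2 j y.
  rewrite /phi_short /digit_weight ltnNge leq_addr /= addKn mulrDl addrA.
  by congr (_ + _); rewrite [RHS]mulrC exprS mulrAC.
(* For [S = 0] the leading digits $1, \dots, L-1$ are all long; otherwise $1, \dots, L$ are long and
   $L+1, \dots, L+S-1$ give the short maps with $j = a - L$. *)
case: (S) => [|S'] /=.
  rewrite addn0 cats0; apply/eq_in_allpairs => a y; rewrite mem_iota => lt_a _.
  by apply: longE; lia.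
rewrite addnS /= iotaD map_cat flatten_cat; congr (_ ++ _).
  apply/eq_in_allpairs => a y; rewrite mem_iota => lt_a _.
  by apply: longE; lia.
rewrite addnC iotaDl allpairs_mapl.
by apply/eq_in_allpairs => a y _ _; apply: shortE.
Qed.

Theorem theorem5p3 (R : realType) (L S : nat) (gamma : R)
    (xi : nat -> R) (e : nat -> nat) :
  (1 <= L)%N -> (2 <= L + S)%N ->
  is_gamma L S gamma ->
  is_LSsequence L S gamma xi ->
  increasing_enumeration (in_NLS L S) e ->
  forall m, (1 <= m)%N -> xi m = LSradical_inverse L S gamma (e m).
Proof.
move=> L_gt0 b_gt1 gP xiP eP m m_gt0; have b_gt0 := ltnW b_gt1.
(* Any level whose bound exceeds [e m] would do; $n < b^{n+1}$ makes [n = e m] a convenient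
   choice. *)
pose n := e m.
have [k Ek] : exists k, ((L + S) ^ n.+1 = e m + k.+1)%N.
  exists ((L + S) ^ n.+1 - (e m).+1)%N.
  have: (n < (L + S) ^ n.+1)%N by apply: ltn_trans (ltn_expl _ b_gt1).
  by rewrite /n; lia.
have in_e : in_NLS L S (e m) by apply/(eP.2 _); exists m.
(* Exactly [m.-1] admissible numbers precede [e m], so it has index [m.-1] in this list, and reading
   both sequences there gives the result. *)
have E : NLS_below L S ((L + S) ^ n.+1) =
    [seq e k | k <- iota 1 m.-1] ++ e m :: [seq x <- iota (e m).+1 k | in_NLS L S x].
  by rewrite Ek /NLS_below iotaD filter_cat /= in_e (increasing_enumeration_filter eP).
have [szt _] := size_NLS_below n L_gt0 b_gt1 gP.
have /(congr1 (nth 0 ^~ m.-1)) := xiP n.+1 isT.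
rewrite LSpointsE // -szt E size_cat /= size_map size_iota.
rewrite (nth_map 0%N) ?size_iota ?nth_iota; [|lia..].
rewrite map_cat nth_cat !size_map size_iota ltnn subnn /= => <-.
by rewrite add1n prednK.
Qed.
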